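(* Let $x$ and $x'$ be nonempty modified ascent sequences, let $A=(\beta\circ\bar\alpha)(x)$ and $A'=(\beta\circ\bar\alpha)(x')$ be the corresponding Fishburn matrices, of dimension $p\times p$ and $k\times k$ respectively, with $p<k$, and let $x+x'$ denote the modified ascent sequence that corresponds to $A+A'$; that is, the modified ascent sequence with $(\beta\circ\bar\alpha)(x+x')=A+A'$. Then $$x+x'=\alpha\bigl(\mathfrak{P}(x)+\mathfrak{P}(x')\bigr),$$ where $\alpha$ is the map from Fishburn covers to modified ascent sequences given by the block-insertion procedure.
   Context: Write $[k]=\{1,\dots,k\}$. Trees. A binary tree is either empty or a triple $T=(L,r,R)$ with $r$ a node (the root) and $L,R$ binary trees. $V(T)$ is the set of nodes and the size of $T$ is $|V(T)|$. A vertex labeling is a map $\mathfrak{l}:V(T)\to\{1,2,\dots\}$; $\max(T)$ is the largest label, $\max(\emptyset)=0$. Labeled trees are considered up to label-preserving isomorphism. $T$ is decreasing if it is empty, or $L,R$ are decreasing and $\mathfrak{l}(r)\ge\max\{\max(L),\max(R)\}$; strictly decreasing to the left if it is empty, or $\mathfrak{l}(r)>\max(L)$ and $L,R$ are strictly decreasing to the left. An endotree of size $n$ is a decreasing binary tree of size $n$ that is strictly decreasing to the left with all labels in $[n]$; it is regular if its label set is $[k]$ for some $k\le n$. Let $v_i$ be the $i$-th node visited in the in-order traversal (left subtree, root, right subtree). $\mathrm{asctops}(T)=\{v_1\}\cup\{v_i:v_i\text{ has a left child}\}$, $\mathrm{nub}(T)=\{v_j:\mathfrak{l}(v_i)\ne\mathfrak{l}(v_j)\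 \forall i<j\}$. A Fishburn tree is a regular endotree with $\mathrm{nub}(T)=\mathrm{asctops}(T)$. Paths and covers. A maximal right path is a nonempty sequence of nodes, each the right child of the previous one, whose first node is not a right child and whose last node has no right child; maximal left paths are analogous. $\mathrm{rpath}(v)$ is the maximal right path containing $v$; $\mathrm{diag}(T)$ is the maximal left path containing the root. For a Fishburn tree $T$ with $k=\max(T)$, $\mathrm{asctops}(T)$ has exactly one node of each label $i\in[k]$; if $v$ is that node, $W_i=\mathrm{rpath}(v)$ if $v\in\mathrm{diag}(T)$ and $W_i=\mathrm{rpath}(\text{left child of }v)$ otherwise. Let $B_i$ be the multiset of labels of nodes of $W_i$ and $\mathfrak{P}(T)=B_1\dots B_k$. This is a Fishburn cover, i.e. a list of $k$ nonempty multisets whose elements form exactly the set $[k]$ and such that $j\in B_i$ implies $j\le i$. Sequences. A Cayley permutation is a word $x=x_1\dots x_n$ whose set of values is $[k]$ for some $k$. A modified ascent sequence is a Cayley permutation $x$ with $\mathrm{asctops}(x)=\mathrm{nub}(x)$, where $\mathrm{asctops}(x)=\{(1,x_1)\}\cup\{(i,x_i):1<i\le n,\,x_{i-1}<x_i\}$ and $\mathrm{nub}(x)=\{(\min x^{-1}(j),j):1\le j\le\max(x)\}$. For a word $x$ of positive integers, $\bar\alpha(x)$ is the empty tree if $x$ is empty; otherwise, with $m$ the index of the leftmost maximum of $x$, $\bar\alpha(x)$ has root labeled $x_m$, left subtree $\bar\alpha(x_1\dots x_{m-1})$ and right subtree $\bar\alpha(x_{m+1}\dots x_n)$. It restricts to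 a bijection from modified ascent sequences to Fishburn trees, whose inverse is the in-order sequence. Put $\mathfrak{P}(x)=\mathfrak{P}(\bar\alpha(x))$. Matrices. A Fishburn matrix is a lower triangular square matrix with nonnegative integer entries and no zero row or column. For a Fishburn tree $T$ with $k=\max(T)$, $\beta(T)$ is the $k\times k$ matrix whose $(i,j)$-entry is the number of nodes with label $j$ in $W_i$; $\beta$ is a bijection from Fishburn trees to Fishburn matrices. For a $p\times p$ matrix $A=(a_{i,j})$ and a $k\times k$ matrix $A'=(a'_{i,j})$ with $p\le k$, $A+A'$ is the $k\times k$ matrix with $(i,j)$-entry $a_{i,j}+a'_{i,j}$ if $i\le p$ and $j\le p$, and $a'_{i,j}$ otherwise; the sum of two Fishburn matrices is a Fishburn matrix. Sum of covers. If $P=B_1\dots B_p$ and $P'=B'_1\dots B'_k$ are Fishburn covers with $p<k$, then $P+P'$ is the Fishburn cover $(B_1\cup B'_1)\dots(B_p\cup B'_p)B'_{p+1}\dots B'_k$, where $\cup$ denotes union of multisets with multiplicities added. The map $\alpha$ on covers (block-insertion procedure). Let $P=B_1\dots B_k$ be a Fishburn cover and let $\overrightarrow{B_i}$ be the word listing the elements of $B_i$ in weakly decreasing order. Let $\{i\in[k]:i\in B_i\}=\{i_1<\dots<i_p\}$ and $\{i\in[k]:i\notin B_i\}=\{j_1>\dots>j_q\}$. Let $x^{(0)}=\overrightarrow{B_{i_1}}\,\overrightarrow{B_{i_2}}\dots\overrightarrow{B_{i_p}}$ (concatenation), and for $s=1,\dots,q$ let $x^{(s)}$ be obtained from $x^{(s-1)}$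 by inserting $\overrightarrow{B_{j_s}}$ immediately before the leftmost occurrence of the integer $j_s$. Then $\alpha(P)=x^{(q)}$. *)

(* Defs.v *)
From mathcomp Require Import all_boot all_algebra finmap multiset.

Set Implicit Arguments.
Unset Strict Implicit.
Unset Printing Implicit Defensive.

Local Open Scope mset_scope.
Local Open Scope nat_scope.

(* A node is named by its address: the sequence of turns from the root, with
   [false] for left and [true] for right.  [inorder t] lists V(t). *)

Inductive tree := Leaf | Node of tree & nat & tree.

Definition node := seq bool.

Fixpoint tmax (t : tree) : nat :=
  if t is Node l a r then maxn a (maxn (tmax l) (tmax r)) else 0.

Fixpoint inorder (t : tree) : seq node :=
  if t is Node l _ r then
    [seq false :: v | v <- inorder l] ++ [::] :: [seq true :: v | v <- inorder r]
  else [::].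

Fixpoint subtree (t : tree) (v : node) : tree :=
  match v, t with
  | [::], _ => t
  | b :: v', Node l _ r => subtree (if b then r else l) v'
  | _ :: _, Leaf => Leaf
  end.

(* The value 0 is only returned when [v] is not a node of [t]. *)
Definition label (t : tree) (v : node) : nat :=
  if subtree t v is Node _ a _ then a else 0.

Definition left_child (v : node) : node := rcons v false.

Definition asctops (t : tree) : seq node :=
  [seq v <- inorder t
     | (v == head [::] (inorder t)) || (left_child v \in inorder t)].

(* The nodes met when leaving the root of [t] in direction [b] repeatedly. *)
Fixpoint spine (b : bool) (t : tree) : seq node :=
  if t is Node l _ r then
    [::] :: [seq b :: v | v <- (if b then spine b r else spine b l)]
  else [::].

(* [path_top b v] is [v] without its trailing turns [b], i.e. the first node of the
   maximal path in direction [b] through [v]. *)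
Fixpoint path_top (b : bool) (v : node) : node :=
  if v is c :: v' then
    let u := path_top b v' in if nilp u && (c == b) then [::] else c :: u
  else [::].

Definition rpath (t : tree) (v : node) : seq node :=
  let u := path_top true v in [seq u ++ w | w <- spine true (subtree t u)].

Definition diag (t : tree) : seq node := spine false t.

(* In a Fishburn tree, exactly one node of [asctops t] has label [i] when
   1 <= i <= tmax t. *)
Definition asctop (t : tree) (i : nat) : node :=
  head [::] [seq v <- asctops t | label t v == i].

Definition W (t : tree) (i : nat) : seq node :=
  let v := asctop t i in
  if v \in diag t then rpath t v else rpath t (left_child v).

(* A cover B_1 ... B_k is a list of multisets; B_i is its item of index i.-1. *)
Definition cover := seq {mset nat}.

Definition tree_cover (t : tree) : cover :=
  [seq seq_mset [seq label t v | v <- W t i] | i <- iota 1 (tmax t)].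

Definition cover_sum (P P' : cover) : cover :=
  [seq B.1 `+` B.2 | B <- zip P P'] ++ drop (size P) P'.

(* Labels start at 1, matrix indices at 0. *)
Definition beta (t : tree) : 'M[nat]_(tmax t) :=
  \matrix_(i, j) count (fun v => label t v == j.+1) (W t i.+1).

Definition mx_sum (p k : nat) (A : 'M[nat]_p) (A' : 'M[nat]_k) : 'M[nat]_k :=
  \matrix_(i, j)
    match insub (i : nat) : option 'I_p, insub (j : nat) : option 'I_p with
    | Some i0, Some j0 => A i0 j0 + A' i j
    | _, _ => A' i j
    end.

Definition word_max (x : seq nat) : nat := foldr maxn 0 x.

Definition cayley (x : seq nat) : Prop :=
  exists k, forall j, (j \in x) = (1 <= j <= k).

Definition word_asctops (x : seq nat) : seq (nat * nat) :=
  [seq (i.+1, nth 0 x i)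
     | i <- iota 0 (size x) & (i == 0) || (nth 0 x i.-1 < nth 0 x i)].

Definition word_nub (x : seq nat) : seq (nat * nat) :=
  [seq ((index j x).+1, j) | j <- iota 1 (word_max x)].

Definition modified_ascent (x : seq nat) : Prop :=
  cayley x /\ word_asctops x =i word_nub x.

(* [n] is fuel: any [n >= size x] gives the same tree. *)
Fixpoint abar_rec (n : nat) (x : seq nat) : tree :=
  match n, x with
  | n'.+1, _ :: _ =>
      let m := index (word_max x) x in
      Node (abar_rec n' (take m x)) (nth 0 x m) (abar_rec n' (drop m.+1 x))
  | _, _ => Leaf
  end.

Definition abar (x : seq nat) : tree := abar_rec (size x) x.

Definition block (P : cover) (i : nat) : {mset nat} := nth mset0 P i.-1.

Definition decreasing_word (B : {mset nat}) : seq nat := sort geq (enum_mset B).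

Definition insert_before (j : nat) (w x : seq nat) : seq nat :=
  take (index j x) x ++ w ++ drop (index j x) x.

Definition alpha (P : cover) : seq nat :=
  let ids := iota 1 (size P) in
  let x0 :=
    flatten [seq decreasing_word (block P i) | i <- ids & i \in block P i] in
  foldl (fun x j => insert_before j (decreasing_word (block P j)) x)
    x0 (rev [seq j <- ids | j \notin block P j]).

(* [beta (abar x)] and [A] have dimensions that are only provably equal. *)
Definition corresponds (k : nat) (A : 'M[nat]_k) (x : seq nat) : Prop :=
  modified_ascent x /\
  exists e : tmax (abar x) = k, castmx (e, e) (beta (abar x)) = A.

(* Main.v *)
Require Import Defs.
From mathcomp Require Import all_boot all_algebra finmap multiset.
From mathcomp Require Import zify.

Set Implicit Arguments.
Unset Strict Implicit.
Unset Printing Implicit Defensive.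

Local Open Scope nat_scope.

(** Write the blocks of a cover as weakly decreasing words [d i].  The spine of the
    left subtree of an ascent top labeled [m] is [d m], unless the ascent top lies on
    the diagonal, in which case its own right path is [d m].

    Recovering a modified ascent sequence from its blocks: delete from its tree the
    left subtrees of all off-diagonal nodes with label below [m].  As [m] decreases,
    each step restores exactly the block [d m], immediately before the ascent top
    [m], which is the first occurrence of [m].

    Conversely, each insertion of [alpha] grafts the right comb of [d j] as the left
    subtree of the first node labeled [j].  This turns that node into an ascent top,
    adds the single block [d j], and creates no other ascent top, because the letters
    of [d j] are smaller than [j].

    So covers and modified ascent sequences determine each other; as matrix entries
    are block multiplicities, the sum of matrices is the sum of covers. *)

(** * In-order words and block lists of trees *)

Fixpoint tree_word (t : tree) : seq nat :=
  if t is Node l a r then tree_word l ++ a :: tree_word r else [::].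

Fixpoint spine_word (t : tree) : seq nat :=
  if t is Node _ a r then a :: spine_word r else [::].

Definition is_leaf (t : tree) : bool := if t is Leaf then true else false.

(** For positive labels this combines decreasing and strictly decreasing to the left; the bounds on
    maxima become bounds on in-order words. *)
Fixpoint left_decreasing (t : tree) : bool :=
  if t is Node l a r then
    [&& left_decreasing l, left_decreasing r,
        all (fun b => b < a) (tree_word l) & all (fun b => b <= a) (tree_word r)]
  else true.

(* The pair of [a] with the labels of the maximal right path starting at the left
   child of [a], for every node [a] that has a left child, in in-order. *)
Fixpoint left_blocks (t : tree) : seq (nat * seq nat) :=
  if t is Node l a r then
    left_blocks l ++ (if is_leaf l then [::] else [:: (a, spine_word l)])
      ++ left_blocks r
  else [::].

(* The pairs (i, labels of W_i), in the in-order of the ascent tops. *)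
Fixpoint blocks (t : tree) : seq (nat * seq nat) :=
  if t is Node l a r then blocks l ++ (a, a :: spine_word r) :: left_blocks r
  else [::].

Definition lookup (s : seq (nat * seq nat)) (i : nat) : seq nat :=
  (head (0, [::]) [seq q <- s | q.1 == i]).2.

Lemma lookup_uniq s q : uniq (unzip1 s) -> q \in s -> lookup s q.1 = q.2.
Proof.
rewrite /lookup; elim: s => //= q0 s IH /andP[Hq0 Us].
rewrite inE => /orP[/eqP->|qs]; first by rewrite eqxx.
case: eqP => [E|_]; last exact: IH.
by move: Hq0; rewrite E map_f.
Qed.

Lemma lookup_mem s i : i \in unzip1 s -> (i, lookup s i) \in s.
Proof.
rewrite /lookup; elim: s => //= q0 s IH.
rewrite !inE eq_sym; case: eqP => [<-|_ /=]; first by case: q0 => *; rewrite eqxx.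
by move=> /IH ->; rewrite orbT.
Qed.

(** * The block list against the paths W_i, given by addresses *)

Lemma subtree_nil t : subtree t [::] = t.
Proof. by case: t. Qed.

Lemma subtree_cat t u v : subtree t (u ++ v) = subtree (subtree t u) v.
Proof.
by elim: u t => [|b u IH] [|l a r] //=; case: (v).
Qed.

Lemma mem_inorder t v : (v \in inorder t) = ~~ is_leaf (subtree t v).
Proof.
have inj b : injective (cons b : node -> node) by move=> u w [].
have nocons b c (u : node) s : b != c -> (b :: u \in [seq c :: w | w <- s]) = false.
  by move=> bc; apply/mapP=> -[w _ [E _]]; rewrite E eqxx in bc.
elim: t v => [|l IHl a r IHr] [|[] v] //=; rewrite mem_cat inE.
- by rewrite orbT.
- by rewrite (nocons true false) //= mem_map.
- by rewrite (nocons false true) //= orbF mem_map.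
Qed.

Lemma labels_spine t : [seq label t v | v <- spine true t] = spine_word t.
Proof.
by elim: t => //= l _ a r IH; rewrite -map_comp -IH.
Qed.

Lemma path_top_rcons b c v :
  b != c -> path_top b (rcons v c) = rcons v c.
Proof.
move=> bc; elim: v => [|d v /= ->] /=; first by rewrite eq_sym (negPf bc).
by case: v.
Qed.

(** A left child is not a right child, so the maximal right path through it starts there. *)
Lemma labels_left_rpath t v :
  [seq label t w | w <- rpath t (left_child v)]
  = spine_word (subtree t (left_child v)).
Proof.
rewrite /rpath /left_child path_top_rcons // -map_comp -labels_spine.
by apply: eq_map => w /=; rewrite /label subtree_cat.
Qed.

Definition nonempty_left (t : tree) (v : node) : bool :=
  ~~ is_leaf (subtree t (left_child v)).

Lemma left_blocksE t :
  left_blocks t = [seq (label t v, spine_word (subtree t (left_child v)))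
                     | v <- inorder t & nonempty_left t v].
Proof.
elim: t => //= l -> a r ->.
rewrite filter_cat map_cat !filter_map -!map_comp; congr (_ ++ _).
rewrite [filter _ (_ :: _)]/= filter_map {2}/nonempty_left [subtree _ _]/= subtree_nil.
by case: (is_leaf l); rewrite /= -map_comp ?subtree_nil.
Qed.

(** The path W_i indexed by its ascent top instead of its label, which suits induction on the
    tree. *)
Definition top_path (t : tree) (v : node) : seq node :=
  if v \in diag t then rpath t v else rpath t (left_child v).

Lemma asctopsE t :
  asctops t = [seq v <- inorder t | (v == head [::] (inorder t)) || nonempty_left t v].
Proof. by apply: eq_filter => v; rewrite mem_inorder. Qed.

Lemma head_inorder l a r :
  head [::] (inorder (Node l a r))
  = if is_leaf l then [::] else false :: head [::] (inorder l).
Proof. by case: l => //= l' b r'; case: (inorder l'). Qed.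

(** The diagonal is the root followed by the diagonal of the left subtree. So the induction follows
    the left subtree, while the right subtree lies off the diagonal and is covered by
    [left_blocks]. *)
Lemma blocksE t :
  blocks t = [seq (label t v, [seq label t w | w <- top_path t v]) | v <- asctops t].
Proof.
elim: t => [|l IHl a r _] //; rewrite asctopsE head_inorder [blocks _]/= {}IHl asctopsE.
have inj b : injective (cons b : node -> node) by move=> u w [].
rewrite filter_cat map_cat /=; congr (_ ++ _).
  rewrite filter_map -map_comp.
  set p := filter _ _; set q := filter _ _.
  (* A nonempty left subtree contains the first node in in-order, so being an ascent top means the
     same in [l] and in the whole tree. *)
  have -> : q = p.
    apply: eq_in_filter => v; rewrite mem_inorder => vl /=.
    by case: l {p q} vl => [|l' b r'] //; case: v.
  apply: eq_map => v /=.
  rewrite /top_path /= inE mem_map //=.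
  case: ifP => _ /=; congr pair; rewrite /rpath /= ?andbF /= -!map_comp;
    exact: eq_map.
rewrite /nonempty_left /= subtree_nil.
(* The root is always an ascent top: it comes first if [l] is empty and has a left child
   otherwise. *)
have -> : ([::] == if is_leaf l then [::] else false :: head [::] (inorder l))
       || ~~ is_leaf l by case: (is_leaf l).
rewrite /=; congr (_ :: _).
  by rewrite /top_path /= /rpath /= -!map_comp -labels_spine.
rewrite filter_map -map_comp left_blocksE.
set p := filter _ _; set q := filter _ _.
(* No node of the right subtree comes first in in-order, so there only left children count. *)
have -> : q = p.
  apply: eq_in_filter => v _ /=.
  by case: eqP => //; case: (is_leaf l).
apply: eq_map => v /=; congr pair.
rewrite /top_path inE /= ifN ?labels_left_rpath //.
by apply/mapP=> -[].
Qed.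

(** Both [asctop] and [lookup] select the first ascent top labeled [i] in in-order. *)
Lemma labels_W t i :
  i \in unzip1 (blocks t) -> [seq label t v | v <- W t i] = lookup (blocks t) i.
Proof.
rewrite /W -/(top_path _ _) /asctop /lookup blocksE.
elim: (asctops t) => //= v s IH; rewrite inE eq_sym.
by case: (label t v == i).
Qed.

(** * [abar] and the in-order word as inverse maps *)

Lemma tmax_word t : tmax t = word_max (tree_word t).
Proof.
rewrite /word_max; elim: t => //= l -> a r ->.
elim: (tree_word l) => /= [|b s <-]; first by rewrite max0n.
by rewrite !maxnA [maxn b a]maxnC.
Qed.

Lemma tree_word_eq0 t : (tree_word t == [::]) = is_leaf t.
Proof. by case: t => //= l a r; case: (tree_word l). Qed.

Lemma mem_word_max x : x != [::] -> word_max x \in x.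
Proof.
rewrite /word_max; case: x => //= a x _; elim: x a => /= [|b x IH] a.
  by rewrite maxn0 mem_seq1.
by rewrite /maxn; case: ifP => _; rewrite inE ?eqxx // IH orbT.
Qed.

Lemma leq_word_max x b : b \in x -> b <= word_max x.
Proof.
rewrite /word_max; elim: x => //= a x IH; rewrite inE leq_max.
by case/orP => [/eqP->|/IH->]; rewrite ?leqnn ?orbT.
Qed.

Lemma word_max_eq x k : k \in x -> all (fun b => b <= k) x -> word_max x = k.
Proof.
move=> kx /allP H; apply/eqP; rewrite eqn_leq leq_word_max // andbT.
by apply: H; apply: mem_word_max; case: (x) kx.
Qed.

Lemma abar_rec_cons n x : x != [::] ->
  let m := index (word_max x) x in
  abar_rec n.+1 x = Node (abar_rec n (take m x)) (word_max x) (abar_rec n (drop m.+1 x)).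
Proof.
move=> xn m; rewrite -(nth_index 0 (mem_word_max xn)) -/m.
by case: x xn @m.
Qed.

Lemma abar_rec_word n x : size x <= n -> tree_word (abar_rec n x) = x.
Proof.
elim: n x => [|n IH] x; first by case: x.
have [->|xn] := eqVneq x [::] => // sx.
rewrite abar_rec_cons //=; set m := index _ _.
have mx : m < size x by rewrite index_mem mem_word_max.
rewrite !IH ?size_take ?size_drop ?mx; try lia.
rewrite -[word_max x in LHS](nth_index 0 (mem_word_max xn)) -/m.
by rewrite -drop_nth // cat_take_drop.
Qed.

(** Cutting at the leftmost maximum leaves strictly smaller letters before it and letters at most as
    large after it. *)
Lemma abar_rec_left_decreasing n x : size x <= n -> left_decreasing (abar_rec n x).
Proof.
elim: n x => [|n IH] x; first by case: x.
have [->|xn] := eqVneq x [::] => // sx.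
rewrite abar_rec_cons //=; set m := index _ _.
have mx : m < size x by rewrite index_mem mem_word_max.
have s1 : size (take m x) <= n by rewrite size_take mx; lia.
have s2 : size (drop m.+1 x) <= n by rewrite size_drop; lia.
rewrite !IH // !abar_rec_word //=.
apply/andP; split; apply/allP => b bin; last exact/leq_word_max/(mem_drop bin).
rewrite ltn_neqAle (leq_word_max (mem_take bin)) andbT.
by apply: contraTneq bin => ->; rewrite in_take ?mem_word_max // ltnn.
Qed.

(** The root label of a left-decreasing tree is the leftmost maximum of the in-order word, so
    [abar_rec] cuts exactly at the root. *)
Lemma abar_rec_tree n t :
  size (tree_word t) <= n -> left_decreasing t -> abar_rec n (tree_word t) = t.
Proof.
elim: n t => [|n IH] [|l a r] //; first by rewrite /= size_cat addnS.
rewrite /= size_cat /= addnS ltnS => sn /and4P[wl wr al ar].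
have E : word_max (tree_word l ++ a :: tree_word r) = a.
  apply: word_max_eq; first by rewrite mem_cat inE eqxx orbT.
  rewrite all_cat /= leqnn ar (sub_all _ al) // => b; exact: ltnW.
have nl : a \notin tree_word l by apply/negP => /(allP al); rewrite ltnn.
case Ew: (_ ++ _) => [|b s]; first by case: (tree_word l) Ew.
rewrite -Ew E index_pivot // take_size_cat // nth_cat ltnn subnn /=.
rewrite drop_cat ltnNge leqnSn /= subSnn /= drop0 !IH //; lia.
Qed.

Lemma abar_word x : tree_word (abar x) = x.
Proof. exact: abar_rec_word. Qed.

Lemma abar_left_decreasing x : left_decreasing (abar x).
Proof. exact: abar_rec_left_decreasing. Qed.

Lemma abar_tree_word t : left_decreasing t -> abar (tree_word t) = t.
Proof. exact: abar_rec_tree. Qed.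

(** * Block keys as ascent tops of the in-order word *)

(** The values of the ascent tops of [x] read after a letter [m]. With [m = 0] and positive letters
    the first position counts as an ascent top. *)
Fixpoint asc_values (m : nat) (x : seq nat) : seq nat :=
  if x is b :: x' then (if m < b then [:: b] else [::]) ++ asc_values b x' else [::].

Lemma asc_values_cat m u v :
  asc_values m (u ++ v) = asc_values m u ++ asc_values (last m u) v.
Proof. by elim: u m => //= b u IH m; rewrite IH catA. Qed.

Lemma asc_values_cons m b x :
  asc_values m (b :: x) = (if m < b then [:: b] else [::]) ++ asc_values b x.
Proof. by []. Qed.

(** A nonempty left subtree ends in a letter below [a]; after an empty one the predecessor of [a] is
    [m]. So having a left child amounts to being an ascent once [a <= m]. *)
Lemma last_tree_word m l a :
  all (fun b => b < a) (tree_word l) ->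
  (last m (tree_word l) < a) = (m < a) || ~~ is_leaf l.
Proof.
rewrite -tree_word_eq0; case: (tree_word l) => [|b s] H; first by rewrite orbF.
by rewrite orbT; apply: (allP H); rewrite /= mem_last.
Qed.

(** The letter [m] read before the tree bounds all labels, so the first node in in-order is not an
    ascent top. *)
Lemma left_blocks_keys m t :
  left_decreasing t -> all (fun b => b <= m) (tree_word t) ->
  unzip1 (left_blocks t) = asc_values m (tree_word t).
Proof.
elim: t m => //= l IHl a r IHr m /and4P[wl wr al ar].
rewrite all_cat /= => /and3P[ml ma mr].
rewrite asc_values_cat asc_values_cons /unzip1 !map_cat -!/unzip1.
rewrite (IHl m) // (IHr a) // last_tree_word // ltnNge ma /=.
by case: (is_leaf l).
Qed.

Lemma blocks_keys t :
  left_decreasing t -> all (fun b => 0 < b) (tree_word t) ->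
  unzip1 (blocks t) = asc_values 0 (tree_word t).
Proof.
elim: t => //= l IHl a r _ /and4P[wl wr al ar].
rewrite all_cat /= => /and3P[ml ma mr].
rewrite asc_values_cat asc_values_cons /unzip1 !map_cat -!/unzip1 /= -!/unzip1.
by rewrite IHl // (left_blocks_keys wr ar) last_tree_word // ma.
Qed.

(** * Contents and shape of the blocks *)

Lemma sub_spine_word t : {subset spine_word t <= tree_word t}.
Proof.
elim: t => //= l _ a r IH b; rewrite inE mem_cat inE => /orP[->|/IH->];
  by rewrite !orbT.
Qed.

Lemma spine_word_sorted t : left_decreasing t -> sorted geq (spine_word t).
Proof.
elim: t => //= l _ a r IH /and4P[_ wr _ /allP ar].
rewrite (path_sortedE (rev_trans leq_trans)) IH // andbT.
by apply/allP => b /sub_spine_word /ar.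
Qed.

Lemma left_blocks_subset t q : q \in left_blocks t -> {subset q.2 <= tree_word t}.
Proof.
elim: t => //= l IHl a r IHr; rewrite !mem_cat => /or3P[/IHl H|ql|/IHr H] b.
- by move=> /H; rewrite mem_cat => ->.
- case: (is_leaf l) ql => //; rewrite mem_seq1 => /eqP-> /sub_spine_word.
  by rewrite mem_cat => ->.
- by move=> /H; rewrite mem_cat inE => ->; rewrite !orbT.
Qed.

Lemma blocks_subset t q : q \in blocks t -> {subset q.2 <= tree_word t}.
Proof.
elim: t => //= l IHl a r _; rewrite mem_cat inE => /or3P[/IHl H|/eqP->|H] b.
- by move=> /H; rewrite mem_cat => ->.
- rewrite mem_cat !inE => /orP[->|/sub_spine_word->]; by rewrite !orbT.
- by move=> /(left_blocks_subset H); rewrite mem_cat inE => ->; rewrite !orbT.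
Qed.

Lemma left_blocks_key_mem t : {subset unzip1 (left_blocks t) <= tree_word t}.
Proof.
elim: t => //= l IHl a r IHr b.
rewrite /unzip1 !map_cat !mem_cat inE => /or3P[/IHl->|bl|/IHr->];
  rewrite ?orbT //.
by case: (is_leaf l) bl => //; rewrite mem_seq1 => ->; rewrite orbT.
Qed.

Lemma blocks_key_mem t : {subset unzip1 (blocks t) <= tree_word t}.
Proof.
elim: t => //= l IHl a r _ b.
rewrite /unzip1 !map_cat !mem_cat !inE => /or3P[/IHl->|->|/left_blocks_key_mem->];
  by rewrite ?orbT.
Qed.

Lemma left_blocks_shape t q : left_decreasing t -> q \in left_blocks t ->
  [/\ q.2 != [::], sorted geq q.2 & all (fun b => b < q.1) q.2].
Proof.
elim: t => //= l IHl a r IHr /and4P[wl wr /allP al ar].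
rewrite !mem_cat => /or3P[/(IHl wl)|ql|/(IHr wr)] //.
case: (boolP (is_leaf l)) ql => // nl; rewrite mem_seq1 => /eqP-> /=; split.
- by case: (l) nl.
- exact: spine_word_sorted.
- by apply/allP => b /sub_spine_word /al.
Qed.

Lemma blocks_shape t q : left_decreasing t -> q \in blocks t ->
  [/\ q.2 != [::], sorted geq q.2 & all (fun b => b <= q.1) q.2].
Proof.
elim: t => //= l IHl a r _ /and4P[wl wr al /allP ar].
rewrite mem_cat inE => /or3P[/(IHl wl)|/eqP-> /=|/(left_blocks_shape wr)[-> -> H]] //.
  have ars : all (fun b => b <= a) (spine_word r).
    by apply/allP => b /sub_spine_word /ar.
  by rewrite (path_sortedE (rev_trans leq_trans)) ars spine_word_sorted // leqnn.
by split=> //; apply: sub_all H => b /ltnW.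
Qed.

(** Every maximal right path starts at the root or at a left child, and these paths cover all
    nodes. *)
Lemma mem_left_blocks t b :
  (b \in tree_word t)
  = has (fun q => b \in q.2) (left_blocks t) || (b \in spine_word t).
Proof.
elim: t => //= l IHl a r IHr; rewrite !has_cat mem_cat !inE IHl IHr.
case: l {IHl} => [|l c r'] /=; first by case: (b == a); rewrite //= ?orbT.
by rewrite orbF; do !case: (_ \in _) => //=; do !case: (_ == _); do !case: has.
Qed.

Lemma mem_blocks t b :
  (b \in tree_word t) = has (fun q => b \in q.2) (blocks t).
Proof.
elim: t => //= l IHl a r IHr; rewrite has_cat mem_cat !inE IHl mem_left_blocks /= inE.
by case: (_ == _); case: (b \in _); rewrite ?orbT ?orbF.
Qed.

(** * Modified ascent sequences by a left-to-right test *)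

(* With [p] the part of the word already read, the ascent tops of [x] are exactly
   the first occurrences of the values that lie in [S]. *)
Fixpoint asctops_first (S : seq nat) (p x : seq nat) : bool :=
  if x is b :: x' then
    ((last 0 p < b) == ((b \notin p) && (b \in S))) && asctops_first S (rcons p b) x'
  else true.

Lemma asctops_first_cat S p u v :
  asctops_first S p (u ++ v) = asctops_first S p u && asctops_first S (p ++ u) v.
Proof.
elim: u p => [|b u IH] p /=; first by rewrite cats0.
by rewrite IH cat_rcons andbA.
Qed.

(** The prefix enters the test only through its last letter and through which values of [S] are
    still new. *)
Lemma asctops_first_ext S S' p p' x :
  last 0 p = last 0 p' ->
  {in x, forall b, (b \notin p) && (b \in S) = (b \notin p') && (b \in S')} ->
  asctops_first S p x = asctops_first S' p' x.
Proof.
elim: x p p' => //= b x IH p p' El Eb; rewrite El Eb ?inE ?eqxx //.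
congr (_ && _); apply: IH => [|c cx]; first by rewrite !last_rcons.
by rewrite !mem_rcons !inE; case: eqP => //= _; apply: Eb; rewrite inE cx orbT.
Qed.

Lemma asc_values_first S p x :
  asctops_first S p x -> {subset x <= S} ->
  uniq (asc_values (last 0 p) x) /\
  asc_values (last 0 p) x =i [predD x & p].
Proof.
elim: x p => [|b x IH] p /=; first by split=> // b; rewrite !inE andbF.
case/andP=> /eqP Eb /IH{}IH xS; rewrite xS ?mem_head // andbT in Eb.
case: IH => [c cx|]; first by apply: xS; rewrite inE cx orbT.
rewrite last_rcons Eb => U M; split.
  case: (boolP (b \in p)) => //= _; rewrite U andbT M !inE.
  by rewrite mem_rcons mem_head.
move=> c; rewrite mem_cat M !inE mem_rcons inE.
case: (boolP (b \in p)) => /= bp; rewrite ?inE; case: eqP => //= ->.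
  by rewrite bp.
by rewrite bp.
Qed.

Lemma asctops_first_last S p x t :
  asctops_first S p x -> t \in x -> t \notin p -> t \in S ->
  last (last 0 p) (take (index t x) x) < t.
Proof.
elim: x p => //= b x IH p /andP[/eqP Eb /IH{}IH].
rewrite inE eq_sym; case: eqP => [E _ tp tS|/= nbt tx tp tS].
  by rewrite /= -E Eb E tp tS.
rewrite -(last_rcons 0 p b); apply: IH => //.
by rewrite mem_rcons inE negb_or tp andbT; apply/eqP=> E; case: nbt.
Qed.

Lemma asctops_firstP S p x :
  asctops_first S p x <->
  forall n, n < size x -> let b := nth 0 x n in
    (last 0 (p ++ take n x) < b) = (b \notin p ++ take n x) && (b \in S).
Proof.
elim: x p => [|a x IH] p /=; first by split.
split.
  case/andP=> /eqP Eb /IH{}IH [|n] /= nx; first by rewrite cats0.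
  by rewrite -cat_rcons IH.
move=> H; apply/andP; split; first by apply/eqP; have := H 0 isT; rewrite /= cats0.
by apply/IH => n nx; have := H n.+1 nx; rewrite /= cat_rcons.
Qed.

Lemma cayley_word_max x k :
  (forall j, (j \in x) = (1 <= j <= k)) -> word_max x = k.
Proof.
move=> H; case: k H => [|k] H.
  by case: x H => // a x H; have := H a; rewrite mem_head; lia.
apply: word_max_eq; first by rewrite H leqnn.
by apply/allP => b; rewrite H => /andP[].
Qed.

(** Both lists pair a position with its letter, so their equality is a test at each position.
    Letters are positive, so the default 0 of [last] makes the first position an ascent top. *)
Lemma modified_ascentP x k :
  (forall j, (j \in x) = (1 <= j <= k)) ->
  modified_ascent x <-> asctops_first (iota 1 k) [::] x.
Proof.
move=> H; have Ek := cayley_word_max H.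
have asc n b : ((n.+1, b) \in word_asctops x)
    = [&& n < size x, nth 0 x n == b & last 0 (take n x) < b].
  apply/mapP/and3P => [[m]|[ns /eqP Eb lb]].
    rewrite mem_filter mem_iota add0n => /and3P[mp _ ms] [-> ->]; split=> //.
    case: m mp ms => [|m] /= mp ms; last by rewrite (take_nth 0) ?last_rcons // ltnW.
    by rewrite take0; have := H (nth 0 x 0); rewrite mem_nth //= => /esym/andP[].
  exists n; last by rewrite Eb.
  rewrite mem_filter mem_iota add0n ns andbT Eb.
  case: n ns {Eb} lb => //= n ns; rewrite andbT.
  by rewrite (take_nth 0) ?last_rcons // ltnW.
have nub n b : ((n.+1, b) \in word_nub x)
    = [&& n < size x, nth 0 x n == b & b \notin take n x].
  apply/mapP/and3P => [[m]|[ns /eqP Eb lb]].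
    rewrite mem_iota Ek add1n ltnS -H => mx [-> ->]; split.
    - by rewrite index_mem.
    - by rewrite nth_index.
    - by rewrite in_take // ltnn.
  have bx : b \in x by rewrite -Eb mem_nth.
  exists b; first by rewrite mem_iota Ek add1n ltnS -H.
  congr (_.+1, _); apply/eqP; rewrite eqn_leq leqNgt -in_take // lb /=.
  by rewrite -Eb index_nth.
split.
  case=> _ E; apply/asctops_firstP => n ns /=.
  have := E (n.+1, nth 0 x n); rewrite asc nub ns eqxx /= => ->.
  by rewrite mem_iota add1n ltnS -H mem_nth ?andbT.
move=> /asctops_firstP Hf; split; first by exists k.
case=> [[|n] b].
  by apply/mapP/mapP => -[].
rewrite asc nub; case: (ltnP n (size x)) => //= ns; case: eqP => //= Eb.
have := Hf n ns; rewrite /= Eb => ->.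
by rewrite mem_iota add1n ltnS -H -Eb mem_nth ?andbT.
Qed.

(** * Insertion into a concatenation *)

Lemma insert_before_catl j w u v :
  j \in u -> insert_before j w (u ++ v) = insert_before j w u ++ v.
Proof.
move=> ju; rewrite /insert_before index_cat ju take_cat drop_cat index_mem ju.
by rewrite -!catA.
Qed.

Lemma insert_before_catr j w u v :
  j \notin u -> insert_before j w (u ++ v) = u ++ insert_before j w v.
Proof.
move=> ju; rewrite /insert_before index_cat (negPf ju) take_cat drop_cat.
by rewrite ltnNge leq_addr /= addKn -!catA.
Qed.

Lemma insert_before_head j w v : insert_before j w (j :: v) = w ++ j :: v.
Proof. by rewrite /insert_before /= eqxx. Qed.

(** * Pruned trees *)

Definition alpha_words (k : nat) (d : nat -> seq nat) : seq nat :=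
  foldl (fun x j => insert_before j (d j) x)
    (flatten [seq d i | i <- iota 1 k & i \in d i])
    (rev [seq j <- iota 1 k | j \notin d j]).

(* [prune m t] is the in-order word of [t] without the left subtrees of the nodes
   labeled less than [m]; [prune_off_diag m t] keeps the left subtrees along the
   diagonal.  Decreasing [m] retraces the insertions made by [alpha]. *)
Fixpoint prune (m : nat) (t : tree) : seq nat :=
  if t is Node l a r then (if m <= a then prune m l else [::]) ++ a :: prune m r
  else [::].

Fixpoint prune_off_diag (m : nat) (t : tree) : seq nat :=
  if t is Node l a r then prune_off_diag m l ++ a :: prune m r else [::].

Lemma sub_prune m t : {subset prune m t <= tree_word t}.
Proof.
elim: t => //= l IHl a r IHr b; rewrite !mem_cat !inE => /or3P[|->|/IHr->];
  rewrite ?orbT //.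
by case: ifP => // _ /IHl->.
Qed.

Lemma sub_prune_off_diag m t : {subset prune_off_diag m t <= tree_word t}.
Proof.
elim: t => //= l IHl a r _ b; rewrite !mem_cat !inE => /or3P[/IHl->|->|/sub_prune->];
  by rewrite ?orbT.
Qed.

(** A node labeled [m] lies only in left subtrees of nodes with larger labels, and those are
    kept. *)
Lemma mem_prune m t : left_decreasing t -> m \in tree_word t -> m \in prune m.+1 t.
Proof.
elim: t => //= l IHl a r IHr /and4P[wl wr /allP al ar].
rewrite !mem_cat !inE => /or3P[ml|->|mr]; rewrite ?orbT //; last by rewrite IHr ?orbT.
by rewrite (al _ ml) IHl.
Qed.

Lemma mem_prune_off_diag m t :
  left_decreasing t -> m \in tree_word t -> m \in prune_off_diag m.+1 t.
Proof.
elim: t => //= l IHl a r _ /and4P[wl wr _ _].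
rewrite !mem_cat !inE => /or3P[ml|->|mr]; rewrite ?orbT //; first by rewrite IHl.
by rewrite mem_prune ?orbT.
Qed.

Lemma prune_low m t : all (fun b => m <= b) (tree_word t) -> prune m t = tree_word t.
Proof.
elim: t => //= l IHl a r IHr; rewrite all_cat /= => /and3P[/IHl-> -> /IHr->] //.
Qed.

Lemma prune_off_diag_low m t :
  all (fun b => m <= b) (tree_word t) -> prune_off_diag m t = tree_word t.
Proof.
by elim: t => //= l IHl a r _; rewrite all_cat /= => /and3P[/IHl-> _ /prune_low->].
Qed.

Lemma prune_high m t : all (fun b => b < m) (tree_word t) -> prune m t = spine_word t.
Proof.
elim: t => //= l _ a r IHr; rewrite all_cat /= => /and3P[_ am /IHr->].
by rewrite leqNgt am.
Qed.

(** The labels of an off-diagonal block come from a left subtree and are below its key, so the test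
    [q.1 \in q.2] singles out the diagonal. *)
Lemma diag_filter t : left_decreasing t ->
  [seq q <- left_blocks t | q.1 \in q.2] = [::].
Proof.
move=> wt; apply/eqP; rewrite -(negbK (_ == _)) -has_filter; apply/hasPn => q qt.
by have [_ _ /allP H] := left_blocks_shape wt qt; apply/negP => /H; rewrite ltnn.
Qed.

(** Once [m] exceeds all labels, only the right paths of diagonal nodes remain: the initial word of
    [alpha]. *)
Lemma prune_off_diag_high m t :
  left_decreasing t -> all (fun b => b < m) (tree_word t) ->
  prune_off_diag m t = flatten (unzip2 [seq q <- blocks t | q.1 \in q.2]).
Proof.
elim: t => //= l IHl a r _ /and4P[wl wr _ _].
rewrite all_cat /= => /and3P[ml _ mr].
rewrite filter_cat /= mem_head diag_filter // /unzip2 map_cat flatten_cat -/unzip2.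
by rewrite IHl // prune_high //= cats0.
Qed.

(** Labels increase strictly up the diagonal, so in-order lists the diagonal blocks as [alpha]
    concatenates them. *)
Lemma sorted_diag_keys t : left_decreasing t ->
  sorted ltn (unzip1 [seq q <- blocks t | q.1 \in q.2]).
Proof.
elim: t => //= l IHl a r _ /and4P[wl wr /allP al _].
rewrite filter_cat /= mem_head diag_filter // /unzip1 map_cat /=.
rewrite (sorted_pairwise ltn_trans) pairwise_cat allrel1r /= andbT.
rewrite -(sorted_pairwise ltn_trans) IHl // andbT.
apply/allP => b /mapP[q]; rewrite mem_filter => /andP[_ ql] ->.
by apply/al/blocks_key_mem/map_f.
Qed.

(** Passing from [m.+1] to [m] restores the left subtrees of nodes labeled [m], and here these are
    all empty. *)
Lemma prune_step_eq m t :
  m \notin unzip1 (left_blocks t) -> prune m t = prune m.+1 t.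
Proof.
elim: t => //= l IHl a r IHr.
rewrite /unzip1 !map_cat !mem_cat !negb_or -!/unzip1 => /and3P[/IHl-> ma /IHr->].
by case: ltngtP ma => // <-; case: l {IHl} => //= l b r' ; rewrite mem_seq1 eqxx.
Qed.

Lemma prune_off_diag_step_eq m t : left_decreasing t ->
  m \notin unzip1 [seq q <- blocks t | q.1 \notin q.2] ->
  prune_off_diag m t = prune_off_diag m.+1 t.
Proof.
elim: t => //= l IHl a r _ /and4P[wl wr _ _].
rewrite filter_cat /= mem_head /= /unzip1 map_cat -!/unzip1 mem_cat negb_or.
case/andP=> /IHl-> // mr; congr (_ ++ _ :: _); apply: prune_step_eq.
move: mr; rewrite (eq_in_filter (a2 := predT)) ?filter_predT // => q qr /=.
by have [_ _ /allP H] := left_blocks_shape wr qr; apply/negP => /H; rewrite ltnn.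
Qed.

(** Here [n] is the letter before the tree. As [m <= n], an ascent at the first [m] forces a left
    child there, and distinct keys make it the only node labeled [m] with one. Its left subtree has
    labels below [m], so only the right path from the left child comes back. *)
Lemma prune_step_insert m n t :
  left_decreasing t -> uniq (unzip1 (left_blocks t)) -> m <= n ->
  m \in tree_word t -> last n (take (index m (tree_word t)) (tree_word t)) < m ->
  exists2 w, (m, w) \in left_blocks t & prune m t = insert_before m w (prune m.+1 t).
Proof.
elim: t n => //= l IHl a r IHr n /and4P[wl wr /allP al /allP ar].
rewrite /unzip1 !map_cat !cat_uniq -!/unzip1 => /and5P[Ul Ulr Ua Uar Ur].
move=> mn mt; rewrite index_cat take_cat.
case: (boolP (m \in tree_word l)) => ml.
  rewrite index_mem ml => Hm; case: (IHl n) => // w wl' ->.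
  exists w; first by rewrite mem_cat wl'.
  have am := al _ ml; rewrite (ltnW am) am insert_before_catl ?mem_prune //.
  rewrite (@prune_step_eq _ r) //; apply/negP => mr.
  by case/hasP: Ulr; exists m; rewrite ?mem_cat ?mr ?orbT //; apply/mapP; exists (m, w).
rewrite [size _ + _ < _]ltnNge leq_addr addKn /=.
have [am|am] := eqVneq a m.
  rewrite -am in ml mn *.
  rewrite /= cats0 => la; rewrite leqnn ltnn cat0s.
  have nl : ~~ is_leaf l by case: (l) la => //=; rewrite ltnNge mn.
  exists (spine_word l); first by rewrite !mem_cat (negPf nl) mem_head orbT.
  rewrite insert_before_head prune_high; last exact/allP.
  rewrite (@prune_step_eq _ r) //; apply/negP => mr.
  by case/hasP: Uar; exists a => //; rewrite (negPf nl) mem_head.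
move: mt; rewrite mem_cat inE (negPf ml) eq_sym (negPf am) /= => mr.
rewrite last_cat /= => Hm.
have ma : m < a by rewrite ltn_neqAle eq_sym am ar.
(* The right subtree is read after the root label, so [a] takes the place of [n]. *)
case: (IHr a) => // [|w wr' ->]; first exact: ltnW.
exists w; first by rewrite !mem_cat wr' !orbT.
rewrite (ltnW ma) ma insert_before_catr; last by apply: contra ml => /sub_prune.
rewrite -cat1s (insert_before_catr w (u := [:: a])) ?mem_seq1 1?eq_sym //=.
by rewrite (@prune_step_eq _ l) //; apply: contra ml => /left_blocks_key_mem.
Qed.

Lemma prune_off_diag_step_insert m t :
  left_decreasing t -> uniq (unzip1 (blocks t)) ->
  m \in tree_word t -> m \notin unzip1 [seq q <- blocks t | q.1 \in q.2] ->
  last 0 (take (index m (tree_word t)) (tree_word t)) < m ->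
  exists2 w, (m, w) \in blocks t
    & prune_off_diag m t = insert_before m w (prune_off_diag m.+1 t).
Proof.
elim: t => //= l IHl a r _ /and4P[wl wr /allP al /allP ar].
rewrite /unzip1 !map_cat cat_uniq /= -!/unzip1 => /and4P[Ul Ulr _ Ur].
move=> mt; rewrite filter_cat /= mem_head /unzip1 map_cat -!/unzip1.
rewrite mem_cat /= inE !negb_or.
case/and3P=> mdl am _; rewrite index_cat take_cat.
case: (boolP (m \in tree_word l)) => ml.
  rewrite index_mem ml => Hm; case: IHl => // w wl' ->.
  exists w; first by rewrite mem_cat wl'.
  rewrite insert_before_catl ?mem_prune_off_diag //.
  rewrite (@prune_step_eq _ r) //; apply/negP => mr.
  by move: Ulr => /norP[_ /hasP[]]; exists m => //; apply/mapP; exists (m, w).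
rewrite [size _ + _ < _]ltnNge leq_addr addKn /=.
rewrite [a == m]eq_sym (negPf am) /= last_cat /= => Hm.
move: mt; rewrite mem_cat inE (negPf ml) (negPf am) /= => mr.
have [w wr' ->] := prune_step_insert wr Ur (ar _ mr) mr Hm.
exists w; first by rewrite mem_cat inE wr' !orbT.
rewrite insert_before_catr; last by apply: contra ml => /sub_prune_off_diag.
rewrite -cat1s (insert_before_catr w (u := [:: a])) ?mem_seq1 //=.
rewrite prune_off_diag_step_eq //; apply: contra ml => /mapP[q].
by rewrite mem_filter => /andP[_ ql] ->; apply/blocks_key_mem/map_f.
Qed.

(** * Recovering a modified ascent sequence from its blocks *)

(* The words [d i] stand for the blocks of a Fishburn cover, in weakly decreasing
   order. *)
Definition fishburn_words (k : nat) (d : nat -> seq nat) : Prop :=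
  (forall i, 0 < i <= k ->
     [/\ d i != [::], sorted geq (d i) & all (fun b => 0 < b <= i) (d i)]) /\
  (forall j, 0 < j <= k -> exists2 i, 0 < i <= k & j \in d i).

Lemma modified_ascent_mem x : modified_ascent x ->
  forall j, (j \in x) = (0 < j <= tmax (abar x)).
Proof.
by case=> -[k H] _ j; rewrite tmax_word abar_word (cayley_word_max H) H.
Qed.

Lemma modified_ascent_blocks x : modified_ascent x ->
  uniq (unzip1 (blocks (abar x))) /\ unzip1 (blocks (abar x)) =i x.
Proof.
move=> mx; have H := modified_ascent_mem mx.
have /(modified_ascentP H) Hf := mx.
have [|U M] := asc_values_first Hf.
  by move=> b; rewrite H mem_iota add1n ltnS.
rewrite blocks_keys ?abar_left_decreasing ?abar_word //.
by apply/allP => b; rewrite H => /andP[].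
Qed.

Lemma modified_ascent_fishburn x : modified_ascent x ->
  fishburn_words (tmax (abar x)) (lookup (blocks (abar x))).
Proof.
move=> mx; have H := modified_ascent_mem mx.
have [U M] := modified_ascent_blocks mx.
have w := abar_left_decreasing x.
split=> [i|j]; rewrite -H => xi.
  have qi := lookup_mem (etrans (M i) xi).
  have [-> -> /allP le_i] := blocks_shape w qi; split=> //.
  apply/allP => b bi; rewrite (le_i _ bi) andbT.
  have := blocks_subset qi bi; by rewrite abar_word H => /andP[].
move: (xi); rewrite -{1}(abar_word x) mem_blocks => /hasP[q qx jq].
exists q.1; first by rewrite -H -M map_f.
by rewrite lookup_uniq.
Qed.

Lemma iota1_rcons n : iota 1 n.+1 = rcons (iota 1 n) n.+1.
Proof. by rewrite -[n.+1]addn1 iotaD cats1 add1n addn1. Qed.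

Lemma alpha_words_blocks x : modified_ascent x ->
  alpha_words (tmax (abar x)) (lookup (blocks (abar x))) = x.
Proof.
move=> mx; have H := modified_ascent_mem mx.
have [U M] := modified_ascent_blocks mx.
have w := abar_left_decreasing x.
have /(modified_ascentP H) Hf := mx.
set t := abar x in H U M w Hf *; set k := tmax t; set d := lookup (blocks t).
have Et : tree_word t = x := abar_word x.
have diagP m : (m \in unzip1 [seq q <- blocks t | q.1 \in q.2])
             = (m \in x) && (m \in d m).
  apply/mapP/andP => [[q]|[mx' md]].
    rewrite mem_filter => /andP[q1 qt] ->; rewrite -M map_f //.
    by rewrite /d lookup_uniq.
  by exists (m, d m); rewrite // mem_filter md lookup_mem // M.
have offP m : m \in d m -> m \notin unzip1 [seq q <- blocks t | q.1 \notin q.2].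
  move=> md; apply/mapP => -[q]; rewrite mem_filter => /andP[q1 qt] Em.
  by move: q1; rewrite -(lookup_uniq U qt) -/d -Em md.
have E0 : prune_off_diag k.+1 t = flatten [seq d i | i <- iota 1 k & i \in d i].
  rewrite prune_off_diag_high //; last first.
    by apply/allP => b; rewrite Et H ltnS => /andP[].
  have -> : [seq i <- iota 1 k | i \in d i]
          = unzip1 [seq q <- blocks t | q.1 \in q.2].
    apply: (irr_sorted_eq ltn_trans ltnn).
    - exact/(sorted_filter ltn_trans)/iota_ltn_sorted.
    - exact: sorted_diag_keys.
    - by move=> i; rewrite diagP mem_filter mem_iota add1n ltnS -H andbC.
  rewrite -map_comp; congr flatten; apply/eq_in_map => q /=.
  by rewrite mem_filter => /andP[_ qt]; rewrite /d lookup_uniq.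
(* The word at threshold [n.+1] lacks exactly the off-diagonal blocks with key at most [n]. At
   [n = 0] nothing is pruned, since labels are positive. *)
have step n : n <= k -> foldl (fun y j => insert_before j (d j) y)
    (prune_off_diag n.+1 t) (rev [seq j <- iota 1 n | j \notin d j]) = x.
  elim: n => [|n IH] nk.
    rewrite /= prune_off_diag_low ?Et //.
    by apply/allP => b; rewrite H => /andP[].
  rewrite iota1_rcons filter_rcons; case: (boolP (n.+1 \in d n.+1)) => nd /=.
    by rewrite -prune_off_diag_step_eq ?IH ?offP // ltnW.
  have nx : n.+1 \in x by rewrite H.
  case: (@prune_off_diag_step_insert n.+1 t) => //.
  - by rewrite Et.
  - by rewrite diagP (negPf nd) andbF.
  - rewrite Et; apply: (asctops_first_last (p := [::]) Hf) => //.
    by rewrite mem_iota add1n.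
  move=> v vt Ev; rewrite rev_rcons /=.
  have -> : d n.+1 = v by rewrite -[n.+1]/((n.+1, v).1) /d lookup_uniq.
  by rewrite -Ev IH // ltnW.
by rewrite /alpha_words -E0 step.
Qed.

(** * Ascent tops under block insertion *)

Lemma take_index_cat i (u v : seq nat) :
  take (index i (u ++ v)) (u ++ v)
  = if i \in u then take (index i u) u else u ++ take (index i v) v.
Proof.
rewrite index_cat take_cat; case: (boolP (i \in u)) => iu; first by rewrite index_mem iu.
by rewrite ltnNge leq_addr addKn.
Qed.

Lemma index_split j (x : seq nat) : j \in x ->
  x = take (index j x) x ++ j :: drop (index j x).+1 x.
Proof.
move=> jx; rewrite -[LHS](cat_take_drop (index j x)); congr (_ ++ _).
by rewrite (drop_nth 0) ?index_mem // nth_index.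
Qed.

Lemma notin_take_index j (x : seq nat) : j \notin take (index j x) x.
Proof. by apply/negP => /index_ltn; rewrite ltnn. Qed.

Lemma insert_beforeE j w x : j \in x ->
  insert_before j w x = take (index j x) x ++ w ++ j :: drop (index j x).+1 x.
Proof.
move=> jx; rewrite {1}(index_split jx) insert_before_catr ?notin_take_index //.
by rewrite insert_before_head.
Qed.

Lemma asctops_first_descending S p w :
  path geq (last 0 p) w -> {in w, forall b, b \in S -> b \in p} ->
  asctops_first S p w.
Proof.
elim: w p => //= b w IH p /andP[bp wb] Sp; apply/andP; split.
  rewrite ltnNge [_ <= _]bp /= eq_sym eqbF_neg; apply/andP => -[/negP nb bS].
  by apply/nb/Sp; rewrite ?mem_head.
apply: IH; rewrite ?last_rcons // => c cw cS.
by rewrite mem_rcons inE Sp ?orbT // inE cw orbT.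
Qed.

(** As [j] is not in [S], its first occurrence is no ascent, so the preceding letter is at least [j]
    and the block continues in descent. Afterwards [j] follows a smaller letter and becomes an
    ascent top. Block letters in [S] occurred earlier, so no first occurrence of a value in [S]
    moves into the block. *)
Lemma asctops_first_insert S j w x :
  asctops_first S [::] x -> j \notin S -> j \in x ->
  w != [::] -> sorted geq w -> all (fun b => b < j) w ->
  {in w, forall b, b \in S -> b \in take (index j x) x} ->
  asctops_first (j :: S) [::] (insert_before j w x).
Proof.
move=> xS jS jx wn ws /allP wj wS; rewrite insert_beforeE //.
have := xS; rewrite {1}(index_split jx).
move: wS (notin_take_index j x); set p := take _ _; set s := drop _ _ => wS jp.
rewrite !asctops_first_cat /= => /and3P[Hp].
rewrite jp (negPf jS) eqbF_neg -leqNgt => pj Hs.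
have jw : j \notin w by apply/negP => /wj; rewrite ltnn.
apply/and4P; split.
- rewrite (asctops_first_ext (S' := S) (p' := [::])) // => b bp.
  by rewrite [b \in j :: S]inE; case: eqP bp jp => //= -> ->.
- apply: asctops_first_descending.
    case: w wn ws wj {wS jw} => //= b w _ -> wj; rewrite andbT.
    by apply: leq_trans pj; apply/ltnW/wj; rewrite mem_head.
  move=> b bw; rewrite inE => /orP[/eqP E|]; last exact: wS.
  by rewrite E (negPf jw) in bw.
- rewrite last_cat mem_cat negb_or jp jw mem_head.
  by apply/eqP; case: w wn {ws wS jw} wj => //= b w _ wj; apply/wj/mem_last.
- rewrite (asctops_first_ext (S' := S) (p' := rcons p j)) ?last_rcons // => b bs.
  rewrite !mem_rcons !inE mem_cat; case: eqP => //= _.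
  case: (boolP (b \in p)) => //= bp.
  case: (boolP (b \in w)) => //= bw; apply/esym/negP => bS.
  by rewrite (wS _ bw bS) in bp.
Qed.

(** Each block opens with its key, a new maximum, and then descends. A letter of [S] in the descent
    is at most the key, hence already read, as later keys are larger. *)
Lemma asctops_first_diag S p (d : nat -> seq nat) s :
  sorted ltn s ->
  {in s, forall i, [/\ 0 < i, i \in S & exists2 w, d i = i :: w & path geq i w]} ->
  {in S, forall b, (b \in p) || (b \in s)} ->
  {in s, forall i, all (fun b => b < i) p} ->
  asctops_first S p (flatten [seq d i | i <- s]).
Proof.
elim: s p => //= i s IH p ps sP Sp pl.
have [i0 iS [w dw wi]] := sP _ (mem_head _ _).
have pi : all (fun b => b < i) p by apply/pl/mem_head.
have is_ : {in s, forall j, i < j}.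
  by apply/allP; move: ps; rewrite (path_sortedE ltn_trans) => /andP[].
rewrite asctops_first_cat dw /= iS andbT.
have ip : i \notin p by apply/negP => /(allP pi _); rewrite ltnn.
have li : last 0 p < i.
  by case: (p) pi => // b q /allP H; apply/H/mem_last.
rewrite ip li /=; apply/andP; split.
  apply: asctops_first_descending; first by rewrite last_rcons.
  move=> b bw bS; rewrite mem_rcons inE.
  have := Sp _ bS; rewrite inE => /or3P[->|->|/is_]; rewrite ?orbT //.
  have : b <= i.
    move: wi; rewrite (path_sortedE (rev_trans leq_trans)) => /andP[/allP H _].
    exact: H.
  by rewrite leqNgt => /negPf->.
apply: IH.
- exact: path_sorted ps.
- by move=> j js; apply: sP; rewrite inE js orbT.
- move=> b /Sp; rewrite mem_cat !inE => /or3P[->|->|->]; by rewrite ?orbT.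
- move=> j js; rewrite all_cat pl ?inE ?js ?orbT //=.
  rewrite is_ //=; apply/allP => b bw; apply: leq_ltn_trans (is_ _ js).
  move: wi; rewrite (path_sortedE (rev_trans leq_trans)) => /andP[/allP H _].
  exact: H.
Qed.

(** * Trees of single blocks and of the initial word *)

Fixpoint right_comb (w : seq nat) : tree :=
  if w is a :: w' then Node Leaf a (right_comb w') else Leaf.

Lemma right_comb_word w : tree_word (right_comb w) = w.
Proof. by elim: w => //= a w ->. Qed.

Lemma right_comb_spine w : spine_word (right_comb w) = w.
Proof. by elim: w => //= a w ->. Qed.

Lemma right_comb_blocks w : left_blocks (right_comb w) = [::].
Proof. by elim: w => //= a w ->. Qed.

Lemma right_comb_left_decreasing w : sorted geq w -> left_decreasing (right_comb w).
Proof.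
elim: w => //= a w IH; rewrite (path_sortedE (rev_trans leq_trans)) right_comb_word.
by case/andP=> aw /IH->.
Qed.

(** The tree of the initial word of [alpha], with diagonal labels [s] from the root down. The head
    of [d i] is the diagonal node itself, so only the rest hangs to its right. *)
Fixpoint left_comb (d : nat -> seq nat) (s : seq nat) : tree :=
  if s is i :: s' then Node (left_comb d s') i (right_comb (behead (d i))) else Leaf.

Lemma left_combP (d : nat -> seq nat) s :
  {in s, forall i, exists2 w, d i = i :: w & path geq i w} ->
  sorted gtn s ->
  [/\ left_decreasing (left_comb d s),
      tree_word (left_comb d s) = flatten [seq d i | i <- rev s],
      blocks (left_comb d s) = [seq (i, d i) | i <- rev s] &
      {in s, forall i, all (fun b => b < i)
        (take (index i (tree_word (left_comb d s))) (tree_word (left_comb d s)))}].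
Proof.
elim: s => //= i s IH sP; rewrite (path_sortedE (rev_trans ltn_trans)).
move=> /andP[/allP is_ ss].
case: IH => // [j js|wt Et Eb lr]; first by apply: sP; rewrite inE js orbT.
have [w dw wi] := sP _ (mem_head _ _).
have /andP[aw sw] : all (geq i) w && sorted geq w.
  by rewrite -(path_sortedE (rev_trans leq_trans)).
have lt_i : all (fun b => b < i) (tree_word (left_comb d s)).
  apply/allP => b; rewrite Et => /flatten_mapP[j]; rewrite mem_rev => js.
  have [|v -> ] := sP j; first by rewrite inE js orbT.
  rewrite (path_sortedE (rev_trans leq_trans)) => /andP[/allP vj _].
  rewrite inE => /orP[/eqP->|/vj bj]; first exact: is_.
  by apply: leq_ltn_trans bj _; apply: is_.
rewrite dw /= right_comb_word right_comb_spine right_comb_blocks Et Eb.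
rewrite rev_cons !map_rcons flatten_rcons dw -Et cats1; split=> //.
  by rewrite wt right_comb_left_decreasing // lt_i.
move=> j; rewrite take_index_cat inE => /orP[/eqP->|js].
  rewrite ifN /= ?eqxx ?cats0 //.
  by apply/negP => /(allP lt_i); rewrite ltnn.
rewrite ifT; first exact: lr.
apply: blocks_key_mem; rewrite Eb; apply/mapP; exists (j, d j) => //.
by apply/mapP; exists j; rewrite ?mem_rev.
Qed.

(** * Grafting, the tree form of insertion *)

Fixpoint graft (j : nat) (c t : tree) : tree :=
  if t is Node l a r then
    if j \in tree_word l then Node (graft j c l) a r
    else if a == j then Node c a r else Node l a (graft j c r)
  else Leaf.

Lemma left_blocks_key_sub t :
  {subset unzip1 (left_blocks t) <= unzip1 (blocks t)}.
Proof.
elim: t => //= l IHl a r _ b; rewrite /unzip1 !map_cat !mem_cat /= inE -!/unzip1.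
case/or3P=> [/IHl->|bl|->]; rewrite ?orbT //.
by case: (is_leaf l) bl; rewrite // mem_seq1 => ->; rewrite orbT.
Qed.

Lemma graft_leaf j c t : is_leaf (graft j c t) = is_leaf t.
Proof. by case: t => //= l a r; do !case: ifP. Qed.

Lemma graft_spine j c t : spine_word (graft j c t) = spine_word t.
Proof. by elim: t => //= l _ a r IH; do 2?[case: ifP => _] => //=; rewrite IH. Qed.

Lemma graft_word j c t : j \in tree_word t -> j \notin unzip1 (left_blocks t) ->
  tree_word (graft j c t) = insert_before j (tree_word c) (tree_word t).
Proof.
elim: t => //= l IHl a r IHr jt.
rewrite /unzip1 !map_cat !mem_cat !negb_or -!/unzip1 => /and3P[kl ka kr].
case: ifP => jl /=; first by rewrite insert_before_catl // IHl.
rewrite insert_before_catr ?jl //.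
case: eqP ka => [->|/eqP aj ka] /=.
  rewrite insert_before_head.
  by case: (l) => //= l' b r'; rewrite mem_seq1 eqxx.
move: jt; rewrite mem_cat inE jl eq_sym (negPf aj) /= => jr.
by rewrite -[a :: tree_word r]cat1s insert_before_catr ?mem_seq1 1?eq_sym // IHr.
Qed.

Lemma sub_graft j c t b :
  b \in tree_word (graft j c t) -> (b \in tree_word t) || (b \in tree_word c).
Proof.
elim: t => //= l IHl a r IHr.
by case: ifP => _; [|case: ifP => _]; rewrite /= !mem_cat !inE;
  [case/or3P=> [/IHl/orP[]->|->|->]|case/or3P=> [->|->|->]
  |case/or3P=> [->|->|/IHr/orP[]->]]; rewrite ?orbT.
Qed.

Lemma graft_left_decreasing j c t :
  left_decreasing t -> left_decreasing c -> all (fun b => b < j) (tree_word c) ->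
  j \in tree_word t -> left_decreasing (graft j c t).
Proof.
move=> + wc /allP cj; elim: t => //= l IHl a r IHr /and4P[wl wr al ar] jt.
case: ifP => jl /=.
  rewrite IHl // wr ar andbT /=; apply/allP => b /sub_graft/orP[/(allP al)//|/cj bj].
  by apply: ltn_trans bj _; apply: (allP al).
case: eqP => [E|/eqP aj] /=.
  by rewrite wc wr ar andbT; apply/allP => b /cj; rewrite E.
move: jt; rewrite mem_cat inE jl eq_sym (negPf aj) /= => jr.
rewrite wl IHr // al /=; apply/allP => b /sub_graft/orP[/(allP ar)//|/cj bj].
by apply: leq_trans (ltnW bj) _; apply: (allP ar).
Qed.

(** The graft fills an empty left subtree, so it prolongs no right path; [c] has no left children
    and contributes only its spine. *)
Lemma graft_left_blocks j c t :
  ~~ is_leaf c -> left_blocks c = [::] ->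
  j \in tree_word t -> j \notin unzip1 (left_blocks t) ->
  perm_eq (left_blocks (graft j c t)) ((j, spine_word c) :: left_blocks t).
Proof.
move=> nc bc; elim: t => //= l IHl a r IHr jt.
rewrite /unzip1 !map_cat !mem_cat !negb_or -!/unzip1 => /and3P[kl ka kr].
case: ifP => jl /=.
  by rewrite graft_leaf graft_spine -cat_cons perm_cat2r IHl.
case: eqP ka => [->|/eqP aj ka] /=.
  rewrite bc (negPf nc) /=.
  by case: (l) => //= l' b r'; rewrite mem_seq1 eqxx.
move: jt; rewrite mem_cat inE jl eq_sym (negPf aj) /= => jr.
rewrite -[_ :: left_blocks l ++ _]cat1s perm_sym perm_catCA perm_cat2l.
by rewrite perm_catCA perm_cat2l perm_sym /= IHr.
Qed.

Lemma graft_blocks j c t :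
  ~~ is_leaf c -> left_blocks c = [::] ->
  j \in tree_word t -> j \notin unzip1 (blocks t) ->
  perm_eq (blocks (graft j c t)) ((j, spine_word c) :: blocks t).
Proof.
move=> nc bc; elim: t => //= l IHl a r _ jt.
rewrite /unzip1 map_cat mem_cat /= inE !negb_or -!/unzip1 => /and3P[kl ka kr].
case: ifP => jl /=; first by rewrite -cat_cons perm_cat2r IHl.
rewrite eq_sym (negPf ka) /= graft_spine.
move: jt; rewrite mem_cat inE jl (negPf ka) /= => jr.
rewrite -[(j, _) :: _ ++ _]cat1s perm_sym perm_catCA perm_cat2l /=.
rewrite -[_ :: left_blocks r]cat1s -[_ :: _ ++ _]cat1s perm_catCA perm_cat2l perm_sym.
exact: graft_left_blocks.
Qed.

(* Labels of diagonal nodes are strict left-to-right maxima; this keeps a letter of an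
   inserted block from preceding the first occurrence of its value. *)
Lemma insert_before_record i j w x :
  j \in x -> i != j -> (i \in w -> i \in take (index j x) x) ->
  all (fun b => b < j) w -> all (fun b => b < i) (take (index i x) x) ->
  all (fun b => b < i)
    (take (index i (insert_before j w x)) (insert_before j w x)).
Proof.
move=> jx ij iw wj; rewrite insert_beforeE // {1 2}(index_split jx).
move: iw; set p := take _ _; set s := drop _ _ => iw.
rewrite !take_index_cat; case: ifP => // ip.
rewrite ifF; last by apply/negP => /iw; rewrite ip.
rewrite /= eq_sym (negPf ij) !all_cat /= => /and3P[-> ji ->]; rewrite ji !andbT /=.
by apply: sub_all wj => b bj; apply: ltn_trans ji.
Qed.

(** * The blocks of the word built by insertion *)

(** A tree is carried along with the word, each insertion being a graft. When all keys are present,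
    the ascent test characterizes modified ascent sequences and the blocks are read off the tree. *)
Lemma alpha_words_fishburn k d : fishburn_words k d ->
  let y := alpha_words k d in
  [/\ modified_ascent y, tmax (abar y) = k
    & forall i, 0 < i <= k -> lookup (blocks (abar y)) i = d i].
Proof.
case=> dP dC y.
(* [S] holds the keys present so far. The last clause makes diagonal keys strict left-to-right
   maxima at their first occurrence. *)
pose inv S t := [/\ left_decreasing t, perm_eq (blocks t) [seq (i, d i) | i <- S],
  uniq S, asctops_first S [::] (tree_word t) &
  forall i, 0 < i <= k -> i \in d i ->
    all (fun b => b < i) (take (index i (tree_word t)) (tree_word t))].
have inv_keys S t : inv S t -> unzip1 (blocks t) =i S.
  case=> _ Eb _ _ _; apply: perm_mem; rewrite (perm_trans (perm_map _ Eb)) //.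
  by rewrite -map_comp map_id.
have loop n S t : n <= k -> inv S t ->
    (forall i, (i \in S) = (0 < i <= k) && ((i \in d i) || (n < i))) ->
  exists T t', [/\ inv T t', T =i iota 1 k &
    tree_word t' = foldl (fun x j => insert_before j (d j) x) (tree_word t)
                     (rev [seq j <- iota 1 n | j \notin d j])].
  elim: n S t => [|n IH] S t nk It SP.
    exists S, t; split=> // i; rewrite SP mem_iota add1n ltnS.
    by case: ltngtP; rewrite ?orbT ?andbT // => <-.
  rewrite iota1_rcons filter_rcons; case: (boolP (n.+1 \in d n.+1)) => nd /=.
    apply: (IH S) => //; first exact: ltnW.
    move=> i; rewrite SP; congr (_ && _); rewrite [n < i]leq_eqVlt.
    by case: eqP => [<-|]; rewrite ?nd.
  rewrite rev_rcons /=; set j := n.+1 in nk SP nd *.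
  have [wt Eb US Hf lr] := It; have K := inv_keys _ _ It.
  have jk : 0 < j <= k by [].
  have [dn ds da] := dP _ jk.
  have jS : j \notin S by rewrite SP (negPf nd) ltnn andbF.
  have dj : all (fun b => b < j) (d j).
    apply/allP => b bd; have /andP[_] := allP da _ bd; rewrite leq_eqVlt.
    by case: eqP => //= E; rewrite E (negPf nd) in bd.
  (* Some block [d i] contains [j], with [j <= i]; such a key [i] is already in [S]. *)
  have jt : j \in tree_word t.
    have [i ik jdi] := dC _ jk.
    have [_ _ /allP/(_ _ jdi)/andP[_ ji]] := dP _ ik.
    have iS : i \in S.
      rewrite SP ik /= ltn_neqAle ji andbT.
      by case: eqP => [E|]; rewrite ?orbT // orbF -{1}E jdi.
    apply: (@blocks_subset _ (i, d i)) jdi.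
    by rewrite (perm_mem Eb) map_f.
  (* A key [b] of [S] below [j] is diagonal, so only letters below [b] precede its first occurrence;
     hence [j] does not. *)
  have first_d : {in d j, forall b, b \in S ->
      b \in take (index j (tree_word t)) (tree_word t)}.
    move=> b bd bS; have bj := allP dj _ bd.
    have bt : b \in tree_word t by apply: blocks_key_mem; rewrite K.
    move: (bS); rewrite SP [j < b]ltnNge (ltnW bj) orbF => /andP[bk bdb].
    rewrite in_take // ltnNge leq_eqVlt negb_or; apply/andP; split.
      apply/eqP => /esym/(congr1 (nth 0 (tree_word t))).
      by rewrite !nth_index // => E; rewrite E ltnn in bj.
    apply/negP => jb; have := allP (lr _ bk bdb) j.
    by rewrite in_take // => /(_ jb); rewrite ltnNge (ltnW bj).
  have nc : ~~ is_leaf (right_comb (d j)) by case: (d j) dn.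
  have Ew : tree_word (graft j (right_comb (d j)) t)
            = insert_before j (d j) (tree_word t).
    rewrite graft_word ?right_comb_word //.
    by apply: contra jS => /left_blocks_key_sub; rewrite K.
  rewrite -Ew; apply: (IH (j :: S)).
  - exact: ltnW.
  - split.
    + by rewrite graft_left_decreasing ?right_comb_left_decreasing ?right_comb_word.
    + rewrite (perm_trans (graft_blocks nc _ jt _)) ?right_comb_blocks ?K //.
      by rewrite right_comb_spine perm_cons.
    + by rewrite /= jS.
    + by rewrite Ew asctops_first_insert.
    + move=> i ik id; rewrite Ew; apply: insert_before_record => //.
      * by apply: contra nd => /eqP <-.
      * by move=> ij; apply: first_d => //; rewrite SP ik id.
      * exact: lr.
  - move=> i; rewrite inE SP [n < i]leq_eqVlt -/j.
    by case: eqVneq => [->|]; rewrite ?jk ?eqxx ?orbT //= eq_sym => /negPf->.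
set s := [seq i <- iota 1 k | i \in d i].
have sP i : (i \in s) = (0 < i <= k) && (i \in d i).
  by rewrite mem_filter mem_iota add1n ltnS andbC.
have ss : sorted ltn s by exact/(sorted_filter ltn_trans)/iota_ltn_sorted.
(* Elements of [d i] are at most [i], so a decreasing block containing its key starts with it. *)
have s_head : {in s, forall i, exists2 w, d i = i :: w & path geq i w}.
  move=> i; rewrite sP => /andP[/dP[dn ds /allP da] id].
  case: (d i) dn ds da id => //= a w _ aw da; rewrite inE.
  have /andP[_ ai] := da _ (mem_head _ _).
  move: (aw); rewrite (path_sortedE (rev_trans leq_trans)) => /andP[/allP wa _].
  move=> id; have E : a = i.
    apply/eqP; rewrite eqn_leq ai /=.
    by case/orP: id => [/eqP->|/wa].
  by rewrite E in aw *; exists w.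
have [||wt Et Eb lr] := @left_combP d (rev s).
- by move=> i; rewrite mem_rev; apply: s_head.
- by rewrite rev_sorted.
rewrite revK in Et Eb.
have [|i|T [t [It ST Ey]]] := loop k s (left_comb d (rev s)) (leqnn k).
- split=> //.
  + by rewrite Eb.
  + exact: sorted_uniq ltn_trans ltnn _ ss.
  + rewrite Et; apply: asctops_first_diag => // i is_.
      by split=> //; [move: is_; rewrite sP => /andP[/andP[]]|apply: s_head].
  + by move=> i ik id; apply: lr; rewrite mem_rev sP ik.
- by rewrite sP; case: (ltnP k i); rewrite ?andbF ?orbF.
have {}Ey : tree_word t = y by rewrite Ey Et.
have K := inv_keys _ _ It; have [{}wt {}Eb UT Hf _] := It.
have Ty i : (i \in T) = (0 < i <= k) by rewrite ST mem_iota add1n ltnS.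
have Hy j : (j \in y) = (0 < j <= k).
  rewrite -Ey; apply/idP/idP => [|jk]; last by apply: blocks_key_mem; rewrite K Ty.
  rewrite mem_blocks => /hasP[q]; rewrite (perm_mem Eb) => /mapP[i].
  rewrite Ty => ik -> /= ji; have [_ _ /allP/(_ _ ji)/andP[-> ji']] := dP _ ik.
  by apply: leq_trans ji' _; case/andP: ik.
have Ay : abar y = t by rewrite -Ey abar_tree_word.
split.
- apply/(modified_ascentP Hy); rewrite -Ey.
  by rewrite (asctops_first_ext (S' := T) (p' := [::])) // => b _; rewrite ST.
- by rewrite Ay tmax_word Ey (cayley_word_max Hy).
- move=> i ik; rewrite Ay; apply: (@lookup_uniq _ (i, d i)).
    by rewrite (perm_uniq (perm_map _ Eb)) -map_comp map_id.
  by rewrite (perm_mem Eb) map_f // Ty.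
Qed.

(** * Covers and matrices *)

Lemma count_decreasing_word B b : count_mem b (decreasing_word B) = B b.
Proof. by rewrite -count_mem_mset; apply/permP; rewrite perm_sort. Qed.

Lemma mem_decreasing_word B b : (b \in decreasing_word B) = (b \in B).
Proof. by rewrite mem_sort. Qed.

Lemma decreasing_word_sorted B : sorted geq (decreasing_word B).
Proof. by apply: sort_sorted => a b; apply: leq_total. Qed.

Lemma alphaE P :
  alpha P = alpha_words (size P) (fun i => decreasing_word (block P i)).
Proof.
rewrite /alpha /alpha_words; congr (foldl _ (flatten (map _ _)) (rev _));
  by apply: eq_filter => i; rewrite mem_decreasing_word.
Qed.

Lemma eq_alpha_words k d d' :
  (forall i, 0 < i <= k -> d i = d' i) -> alpha_words k d = alpha_words k d'.
Proof.
move=> E.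
have {}E : {in iota 1 k, d =1 d'} by move=> i; rewrite mem_iota add1n ltnS; apply: E.
rewrite /alpha_words.
have -> : [seq j <- iota 1 k | j \notin d' j] = [seq j <- iota 1 k | j \notin d j].
  by apply: eq_in_filter => i /E->.
have -> : [seq j <- iota 1 k | j \in d' j] = [seq j <- iota 1 k | j \in d j].
  by apply: eq_in_filter => i /E->.
have -> : [seq d' i | i <- iota 1 k & i \in d i] = [seq d i | i <- iota 1 k & i \in d i].
  by apply/eq_in_map => i; rewrite mem_filter => /andP[_ /E].
set r := rev _; have {E} : {in r, d =1 d'}.
  by move=> i; rewrite mem_rev mem_filter => /andP[_ /E].
elim: r (flatten _) => //= i r IH x E; rewrite E ?mem_head // IH // => j jr.
by apply: E; rewrite inE jr orbT.
Qed.

Lemma block_tree_cover t i :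
  0 < i <= tmax t -> block (tree_cover t) i = seq_mset [seq label t v | v <- W t i].
Proof.
case: i => // i ik; rewrite /block /tree_cover (nth_map 0) ?size_iota //.
by rewrite nth_iota.
Qed.

Lemma labels_W_modified_ascent x i : modified_ascent x -> 0 < i <= tmax (abar x) ->
  [seq label (abar x) v | v <- W (abar x) i] = lookup (blocks (abar x)) i.
Proof.
move=> mx; rewrite -(modified_ascent_mem mx) => ix; apply: labels_W.
by have [_ ->] := modified_ascent_blocks mx.
Qed.

Lemma betaE x : modified_ascent x -> forall i j : 'I_(tmax (abar x)),
  beta (abar x) i j = count_mem j.+1 (lookup (blocks (abar x)) i.+1).
Proof.
move=> mx i j; rewrite mxE -(labels_W_modified_ascent mx) ?ltn_ord //.
by rewrite count_map.
Qed.

Lemma correspondsP k (A : 'M[nat]_k) x : modified_ascent x ->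
  corresponds A x <-> tmax (abar x) = k /\
    forall i j : 'I_k, A i j = count_mem j.+1 (lookup (blocks (abar x)) i.+1).
Proof.
move=> mx; split=> [[_ [e <-]]|[e EA]].
  by split=> // i j; rewrite castmxE betaE.
split=> //; exists e; apply/matrixP => i j.
by rewrite castmxE betaE //= EA.
Qed.

Lemma size_cover_sum (P P' : Defs.cover) :
  size P <= size P' -> size (cover_sum P P') = size P'.
Proof.
by move=> h; rewrite size_cat size_map size_zip size_drop (minn_idPl h) subnKC.
Qed.

(** Past the end of [P] the default block [mset0] adds nothing, so one formula serves all
    indices. *)
Lemma block_cover_sum (P P' : Defs.cover) i b : size P <= size P' -> 0 < i ->
  block (cover_sum P P') i b = block P i b + block P' i b.
Proof.
case: i => // i h _; rewrite /block /cover_sum /= nth_cat size_map size_zip.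
rewrite (minn_idPl h); case: ltnP => ip.
  rewrite (nth_map (mset0, mset0)) ?size_zip ?(minn_idPl h) //.
  by rewrite nth_zip_cond size_zip (minn_idPl h) ip msetE2.
by rewrite nth_drop subnKC // [nth _ P _]nth_default // mset0E.
Qed.

(** A decreasing word is determined by its multiplicities, and all its letters lie in [k], so the
    matrix entries record them all. *)
Lemma fishburn_words_eq k d d' : fishburn_words k d -> fishburn_words k d' ->
  (forall i j : 'I_k, count_mem j.+1 (d i.+1) = count_mem j.+1 (d' i.+1)) ->
  forall i, 0 < i <= k -> d i = d' i.
Proof.
move=> [dP _] [dP' _] E i ik.
have [_ ds /allP da] := dP _ ik; have [_ ds' /allP da'] := dP' _ ik.
apply: (sorted_eq (rev_trans leq_trans) _ ds ds').
  by move=> a b; rewrite /= andbC => /anti_leq.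
apply/allP => b _; apply/eqP => /=.
case: (boolP (0 < b <= k)) => [|bk].
  case: b i ik {ds ds' da da'} => // b [] // i ik bk.
  exact: (E (Ordinal ik) (Ordinal bk)).
rewrite !(count_memPn _) //; apply: contra bk; [move/da'|move/da];
  by case/andP=> -> bi; apply: leq_trans bi _; case/andP: ik.
Qed.

Lemma cover_sum_fishburn P P' :
  size P <= size P' ->
  fishburn_words (size P) (fun i => decreasing_word (block P i)) ->
  fishburn_words (size P') (fun i => decreasing_word (block P' i)) ->
  fishburn_words (size P')
    (fun i => decreasing_word (block (cover_sum P P') i)).
Proof.
move=> h [dP _] [dP' dC'].
have mem i b : 0 < i -> (b \in decreasing_word (block (cover_sum P P') i))
    = (b \in decreasing_word (block P i)) || (b \in decreasing_word (block P' i)).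
  move=> i0; rewrite !mem_decreasing_word -!mset_neq0 block_cover_sum //.
  by rewrite addn_eq0 negb_and.
split=> [i ik|j /dC'[i ik ji]]; last first.
  by exists i => //; rewrite mem ?ji ?orbT //; case/andP: ik.
have i0 : 0 < i by case/andP: ik.
have [dn _ /allP da] := dP' _ ik; split.
- case E: (decreasing_word _) => //; case: (decreasing_word _) dn (mem i) => // b s _.
  by move/(_ b i0); rewrite E mem_head orbT.
- exact: decreasing_word_sorted.
- apply/allP => b; rewrite mem // => /orP[|/da//].
  case: (leqP i (size P)) => ip.
    have [|_ _ /allP] := dP i; first by rewrite i0.
    by apply.
  rewrite mem_decreasing_word /block nth_default ?in_mset0 //.
  by case: (i) ip.
Qed.

Lemma size_tree_cover t : size (tree_cover t) = tmax t.
Proof. by rewrite size_map size_iota. Qed.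

Lemma decreasing_word_tree_cover x i :
  modified_ascent x -> 0 < i <= tmax (abar x) ->
  decreasing_word (block (tree_cover (abar x)) i) = lookup (blocks (abar x)) i.
Proof.
move=> mx ik; rewrite block_tree_cover // labels_W_modified_ascent //.
have [/(_ _ ik)[_ s _] _] := modified_ascent_fishburn mx.
apply: (sorted_eq (rev_trans leq_trans) _ (decreasing_word_sorted _) s).
  by move=> a b; rewrite /= andbC => /anti_leq.
by rewrite perm_sort perm_eq_seq_mset.
Qed.

Lemma eq_fishburn_words k d d' :
  (forall i, 0 < i <= k -> d i = d' i) -> fishburn_words k d -> fishburn_words k d'.
Proof.
move=> E [dP dC]; split=> [i ik|j /dC[i ik ji]]; first by rewrite -E //; apply: dP.
by exists i; rewrite // -E.
Qed.

Lemma tree_cover_fishburn x : modified_ascent x ->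
  fishburn_words (size (tree_cover (abar x)))
    (fun i => decreasing_word (block (tree_cover (abar x)) i)).
Proof.
move=> mx; rewrite size_tree_cover.
apply: eq_fishburn_words (modified_ascent_fishburn mx) => i ik.
by rewrite decreasing_word_tree_cover.
Qed.

Lemma mx_sum_beta x x' : modified_ascent x -> modified_ascent x' ->
  tmax (abar x) <= tmax (abar x') ->
  forall i j : 'I_(tmax (abar x')),
  mx_sum (beta (abar x)) (beta (abar x')) i j
  = block (cover_sum (tree_cover (abar x)) (tree_cover (abar x'))) i.+1 j.+1.
Proof.
move=> mx mx' h i j; rewrite block_cover_sum ?size_tree_cover //.
rewrite -[block (tree_cover (abar x')) _ _]count_decreasing_word.
rewrite decreasing_word_tree_cover ?ltn_ord // -betaE // mxE.
case: insubP => [i0 _ Ei|]; last first.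
  rewrite -leqNgt => pi; rewrite /block nth_default ?size_tree_cover //.
  by rewrite mset0E.
rewrite -Ei -[block _ _ _]count_decreasing_word.
rewrite decreasing_word_tree_cover ?ltn_ord //.
(* In a row of [A] but a column beyond it, the matrix sum omits [A]; the block agrees, as its labels
   are at most its index. *)
case: insubP => [j0 _ Ej|]; first by rewrite betaE // Ej.
rewrite -leqNgt => pj; rewrite (count_memPn _) //.
have [/(_ i0.+1 (ltn_ord i0))[_ _ /allP da] _] := modified_ascent_fishburn mx.
by apply/negP => /da/andP[_]; rewrite leqNgt ltnS (leq_trans (ltn_ord i0) pj).
Qed.

(** Since x+x' is defined by its matrix, [unique] asserts both that the word has the matrix A+A' and
    that no other modified ascent sequence has it. *)
Theorem mainTheorem7 (x x' : seq nat)
    (hx : modified_ascent x) (hx' : modified_ascent x')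
    (nx : x <> [::]) (nx' : x' <> [::])
    (hpk : tmax (abar x) < tmax (abar x')) :
  unique (corresponds (mx_sum (beta (abar x)) (beta (abar x'))))
    (alpha (cover_sum (tree_cover (abar x)) (tree_cover (abar x')))).
Proof.
have le_pk := ltnW hpk.
set P := cover_sum _ _; pose d i := decreasing_word (block P i).
have Ek : size P = tmax (abar x').
  by rewrite size_cover_sum ?size_tree_cover.
have dF : fishburn_words (tmax (abar x')) d.
  have := @cover_sum_fishburn (tree_cover (abar x)) (tree_cover (abar x')).
  by rewrite !size_tree_cover; apply=> //; rewrite -size_tree_cover;
    apply: tree_cover_fishburn.
rewrite alphaE Ek -/d.
have [my Ey dy] := alpha_words_fishburn dF.
split.
  apply/correspondsP => //; split=> // i j.
  by rewrite dy ?ltn_ord // mx_sum_beta // count_decreasing_word.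
move=> y cy; have mz : modified_ascent y by case: cy.
have [Ez Az] := (correspondsP _ mz).1 cy.
(* Any competitor is rebuilt from its own blocks, and equal matrices give equal blocks. *)
rewrite -[RHS](alpha_words_blocks mz) Ez; apply: eq_alpha_words.
apply: fishburn_words_eq dF _ _.
  by rewrite -Ez; apply: modified_ascent_fishburn.
by move=> i j; rewrite -Az mx_sum_beta // count_decreasing_word.
Qed.
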